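(* Let $\Lambda$ be a directed graph with $n_e$ edges and $n_{\mathrm{bif}}$ bifurcation nodes as described in the context, and let $$A_{\mathrm{diff}}=\begin{bmatrix}B&C\\ C^T&D\end{bmatrix}$$ be the $(n_e+n_{\mathrm{bif}})\times(n_e+n_{\mathrm{bif}})$ diffusion matrix defined in the context. Then $A_{\mathrm{diff}}$ is invertible and the discrete diffusion problem with matrix $A_{\mathrm{diff}}$ is positive: for every $\mathbf{g}\in\mathbb{R}^{n_e+n_{\mathrm{bif}}}$ with $\mathbf{g}\ge 0$ (entrywise), the solution $\mathbf{u}$ of $A_{\mathrm{diff}}\mathbf{u}=\mathbf{g}$ satisfies $\mathbf{u}\ge 0$.
   Context: $\Lambda=(\mathcal{E},\mathcal{N})$ is a finite, connected, simple, directed graph with edges $e_1,\dots,e_{n_e}$, where $e_k$ has length $|e_k|$ and is parametrized by a map $\pi_k:[0,1]\to e_k$ running opposite to the direction of the edge: $e_k$ is outgoing from its inflow endpoint $\pi_k(1)$ and incoming to its outflow endpoint $\pi_k(0)$. Boundary nodes belong to exactly one edge; internal nodes are shared by at least two edges, and each internal node has at least one incoming and one outgoing edge. Bifurcation nodes are the nodes shared by more than two edges; their set is $\mathcal{N}_{\mathrm{bif}}=\{v_1,\dots,v_{n_{\mathrm{bif}}}\}$. The boundary nodes are divided into the set $\mathcal{N}_s$ of Dirichlet nodes, which are sources (no incoming edges), and the set $\mathcal{N}_e$ of end nodes with homogeneous Neumann conditions, which are sinks (no outgoing edges). It is assumed that $|\mathcal{N}_s|>0$. The diffusion coefficient is a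 function $\nu:\Lambda\to[0,+\infty)$, with restriction $\nu_k$ to $e_k$. The matrix arises from a finite volume two-point flux discretization of $-\frac{d}{ds}\left(\nu\frac{du}{ds}\right)=0$ on $\Lambda$, with one unknown per edge and one per bifurcation node. The blocks $B\in\mathbb{R}^{n_e\times n_e}$, $C\in\mathbb{R}^{n_e\times n_{\mathrm{bif}}}$ and the diagonal block $D\in\mathbb{R}^{n_{\mathrm{bif}}\times n_{\mathrm{bif}}}$ are as follows. - $C_{k,j}=-\frac{\nu_k(v_j)}{|e_k|}\,\frac{2}{|e_k|}$ if $\pi_k(1)=v_j$ or $\pi_k(0)=v_j$ with $v_j\in\mathcal{N}_{\mathrm{bif}}$, and $C_{k,j}=0$ otherwise. Here $2/|e_k|$ is the inverse of the distance from the center of $e_k$ to $v_j$. - $D_{j,j}=-\sum_{i=1}^{n_e}C_{i,j}$, and $D_{k,j}=0$ for $k\ne j$. - For $k\ne j$: $B_{k,j}=-\frac{\nu_k(v)}{|e_k|}\left(\frac{|e_k|+|e_j|}{2}\right)^{-1}$ if $e_j$ and $e_k$ are neighbouring edges meeting at a node $v\notin\mathcal{N}_{\mathrm{bif}}$, and $B_{k,j}=0$ otherwise. - $B_{k,k}=-\sum_{j\ne k}B_{k,j}-\sum_{j=1}^{n_{\mathrm{bif}}}C_{k,j}$ if $\pi_k(1)\notin\mathcal{N}_s$, and $B_{k,k}=-\sum_{j\ne k}B_{k,j}-\sum_{j=1}^{n_{\mathrm{bif}}}C_{k,j}+\nu_k(\pi_k(1))\frac{2}{|e_k|}$ if $\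pi_k(1)\in\mathcal{N}_s$.
   Formalization: The diffusion coefficient is additionally assumed positive at every endpoint of each edge other than the Neumann end nodes; with only ν ≥ 0 the claim fails (ν = 0 gives the zero matrix, which is singular). *)

(* Defs.v *)
From mathcomp Require Import all_boot all_order all_algebra.
Set Implicit Arguments.
Unset Strict Implicit.
Unset Printing Implicit Defensive.
Import Order.TTheory GRing.Theory Num.Theory.
Local Open Scope ring_scope.

(* The edge [e_k] runs from [inflow k] to [outflow k].  Its parametrization
   [pi_k : [0,1] -> e_k] is opposite to its direction, so that
   [inflow k = pi_k(1)] and [outflow k = pi_k(0)]. *)
Record digraph := Digraph {
  node : finType;
  ne : nat;
  inflow : 'I_ne -> node;
  outflow : 'I_ne -> node
}.

Section Graph.
Variable G : digraph.
Implicit Types (k j : 'I_(ne G)) (u v : node G).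

Definition incident k v : bool := (inflow k == v) || (outflow k == v).

Definition degree v : nat := #|[set k | incident k v]|.

Definition has_incoming v : bool := [exists k, outflow k == v].
Definition has_outgoing v : bool := [exists k, inflow k == v].

(* Antiparallel edges are not excluded. *)
Definition simple_digraph : Prop :=
  (forall k, inflow k != outflow k) /\
  injective (fun k => (inflow k, outflow k)).

Definition adjacent u v : bool :=
  [exists k, [&& incident k u, incident k v & u != v]].

Definition connected_digraph : Prop := forall u v, connect adjacent u v.

Definition boundary_nodes : {set node G} := [set v | degree v == 1%N].
Definition internal_nodes : {set node G} := [set v | (2 <= degree v)%N].
Definition bif_nodes : {set node G} := [set v | (2 < degree v)%N].

(* In a loop-free graph a boundary node has either no incoming or no outgoing
   edge, so these two sets partition [boundary_nodes]. *)
Definition source_nodes : {set node G} :=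
  [set v in boundary_nodes | ~~ has_incoming v].
Definition end_nodes : {set node G} :=
  [set v in boundary_nodes | ~~ has_outgoing v].

Definition nbif : nat := #|bif_nodes|.
Definition bif_node (j : 'I_nbif) : node G := enum_val j.

Section Matrix.
Variables (R : realFieldType) (len : 'I_(ne G) -> R).

(* [nu k t] is [nu_k (pi_k t)], relevant for [t] in [0,1].  The functions of
   two edges are not required to agree at a shared node. *)
Variable nu : 'I_(ne G) -> R -> R.

(* [nu_k (v)], for an endpoint [v] of [e_k]. *)
Definition nu_at k v : R := if v == inflow k then nu k 1 else nu k 0.

Definition blockC : 'M[R]_(ne G, nbif) :=
  \matrix_(k, j)
    if incident k (bif_node j)
    then - (nu_at k (bif_node j) / len k * (2 / len k)) else 0.

Definition blockD : 'M[R]_nbif :=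
  \matrix_(k, j) if k == j then - \sum_(i < ne G) blockC i j else 0.

(* A non-bifurcation node shared by two distinct edges [e_k] and [e_j] is
   unique, hence [pick] involves no choice, as soon as the graph is simple,
   connected and has a boundary node. *)
Definition offdiagB k j : R :=
  if [pick v | [&& incident k v, incident j v & v \notin bif_nodes]] is Some v
  then - (nu_at k v / len k * ((len k + len j) / 2)^-1) else 0.

Definition blockB : 'M[R]_(ne G) :=
  \matrix_(k, j)
    if k == j then
      - \sum_(i < ne G | i != k) offdiagB k i - \sum_(i < nbif) blockC k i
      + (if inflow k \in source_nodes
         then nu_at k (inflow k) * (2 / len k) else 0)
    else offdiagB k j.

Definition Adiff : 'M[R]_(ne G + nbif) :=
  block_mx blockB blockC blockC^T blockD.

End Matrix.
End Graph.

(* Main.v *)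
(* The matrix has nonpositive off-diagonal entries, and its row sums vanish
   except on the edges leaving a Dirichlet node, where they are positive.  If
   [A u >= 0] and the minimum of [u] were negative, the set of indices where it
   is attained would be closed under [A i j != 0] and meet no row with positive
   sum; but by connectedness such a set contains every edge. *)
Require Import Defs.
From mathcomp Require Import all_boot all_order all_algebra.
Import Order.TTheory GRing.Theory Num.Theory.
Local Open Scope ring_scope.

Section WeaklyChained.
Variables (R : realFieldType) (n : nat) (A : 'M[R]_n).
Hypothesis offdiag_le0 : forall i j, i != j -> A i j <= 0.
Hypothesis rowsum_ge0 : forall i, 0 <= \sum_j A i j.
(** Weakly chained diagonal dominance, phrased with closed sets instead of paths: applied to the set
    of indices reachable from [i] through nonzero entries, it yields a reachable row that is
    strictly dominant. *)
Hypothesis chained : forall S : {set 'I_n}, S != set0 ->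
  (forall i j, i \in S -> i != j -> A i j != 0 -> j \in S) ->
  exists2 i, i \in S & 0 < \sum_j A i j.

Lemma weakly_chained_monotone (u : 'cV[R]_n) :
  (forall i, 0 <= (A *m u) i 0) -> forall i, 0 <= u i 0.
Proof.
move=> Au_ge0 i1; rewrite leNgt; apply/negP => ui1_lt0.
case: (arg_minP (fun i => u i 0) (erefl true : xpredT i1)) => i0 _ u_min.
set m := u i0 0 in u_min.
have m_lt0 : m < 0 by apply: le_lt_trans ui1_lt0; apply: u_min.
(* Shifting [u] by its minimum splits row [i] into two parts, both nonpositive wherever
   [u i 0 = m]. *)
have row_eq i : (A *m u) i 0 = \sum_j A i j * (u j 0 - m) + (\sum_j A i j) * m.
  rewrite mxE mulr_suml -big_split /=; apply: eq_bigr => j _.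
  by rewrite -mulrDr subrK.
have term_le0 i j : u i 0 = m -> A i j * (u j 0 - m) <= 0.
  move=> ui; have [<-|ne_ij] := eqVneq i j; first by rewrite ui subrr mulr0.
  by rewrite mulr_le0_ge0 ?offdiag_le0 // subr_ge0 u_min.
have sum_le0 i : u i 0 = m -> \sum_j A i j * (u j 0 - m) <= 0.
  by move=> ui; apply: sumr_le0 => j _; apply: term_le0.
have prod_le0 i : (\sum_j A i j) * m <= 0.
  by rewrite mulr_ge0_le0 ?rowsum_ge0 // ltW.
have [||i] := chained [set i | u i 0 == m].
- by apply/set0Pn; exists i0; rewrite inE.
- move=> i j; rewrite !inE => /eqP ui _ Aij_neq0.
  have sum_eq0 : \sum_j A i j * (u j 0 - m) = 0.
    apply/eqP; rewrite eq_le sum_le0 //=.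
    by have := Au_ge0 i; rewrite row_eq => /le_trans; apply; rewrite gerDl.
  (* A vanishing sum of terms of one sign has only zero terms, so [A i j != 0] forces [u j 0 = m].
     The negation makes the terms nonnegative, as [psumr_eq0] expects. *)
  have /eqP : \sum_j - (A i j * (u j 0 - m)) = 0 by rewrite sumrN sum_eq0 oppr0.
  rewrite psumr_eq0 => [|k _]; last by rewrite oppr_ge0 term_le0.
  move=> /allP/(_ j (mem_index_enum _)) /=.
  by rewrite oppr_eq0 mulf_eq0 (negPf Aij_neq0) subr_eq0.
- rewrite inE => /eqP ui rowsum_gt0; have := Au_ge0 i.
  by rewrite row_eq leNgt ltr_wnDl ?sum_le0 // nmulr_llt0.
Qed.

(** If [A] kills a vector, monotonicity applies to it and to its opposite, so it is zero. *)
Lemma weakly_chained_unitmx : A \in unitmx.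
Proof.
rewrite -unitmx_tr -row_free_unit; apply: inj_row_free => v vA0.
have Av0 : A *m v^T = 0 by rewrite -[A]trmxK -trmx_mul vA0 trmx0.
apply/rowP => i; rewrite mxE; apply/eqP; rewrite eq_le; apply/andP; split.
  have := @weakly_chained_monotone (- v^T) _ i; rewrite !mxE oppr_ge0; apply.
  by move=> j; rewrite mulmxN Av0 oppr0 mxE.
have := @weakly_chained_monotone v^T _ i; rewrite mxE; apply.
by move=> j; rewrite Av0 mxE.
Qed.

End WeaklyChained.

Lemma incident_inflow (G : digraph) (k : 'I_(ne G)) : incident k (inflow k).
Proof. by rewrite /incident eqxx. Qed.

Lemma degree_gt1 {G : digraph} {k j : 'I_(ne G)} {v : node G} :
  k != j -> incident k v -> incident j v -> (1 < degree v)%N.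
Proof.
move=> ne_kj kv jv; have <- : #|[set k; j]| = 2%N by rewrite cards2 ne_kj.
by apply/subset_leq_card/subsetP => i; rewrite !inE => /orP[]/eqP->.
Qed.

(** End nodes have degree 1. This brings every node shared by two edges within reach of [nu_gt0]. *)
Lemma notin_end_nodes (G : digraph) (v : node G) :
  (1 < degree v)%N -> v \notin end_nodes G.
Proof. by move=> dv; rewrite !inE gtn_eqF. Qed.

Lemma bif_nodeP {G : digraph} {v : node G} :
  v \in bif_nodes G -> exists j, bif_node (G := G) j = v.
Proof.
by move=> vb; exists (enum_rank_in vb v); rewrite /bif_node enum_rankK_in.
Qed.

Lemma source_inflow {G : digraph} {s : node G} :
  s \in source_nodes G -> exists k, inflow k = s.
Proof.
rewrite !inE => /andP[/eqP ds /existsPn no_in].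
have /card_gt0P[k] : (0 < degree s)%N by rewrite ds.
by rewrite inE /incident (negPf (no_in k)) orbF => /eqP <-; exists k.
Qed.

Section DiffusionMatrix.
Variables (R : realFieldType) (G : digraph).
Variables (len : 'I_(ne G) -> R) (nu : 'I_(ne G) -> R -> R).
Hypothesis len_gt0 : forall k, 0 < len k.
Hypothesis nu_gt0 : forall (k : 'I_(ne G)) (v : node G),
  incident k v -> v \notin end_nodes G -> 0 < nu_at nu k v.

Lemma blockC_lt0 k j : incident k (bif_node j) -> blockC len nu k j < 0.
Proof.
move=> kj; rewrite mxE kj oppr_lt0 !(mulr_gt0, divr_gt0, invr_gt0) ?ltr0n //.
apply/nu_gt0/notin_end_nodes => //.
by have := enum_valP j; rewrite inE => /ltnW.
Qed.

Lemma blockC_le0 k j : blockC len nu k j <= 0.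
Proof.
have [/blockC_lt0/ltW//|nkj] := boolP (incident k (bif_node j)).
by rewrite mxE (negPf nkj).
Qed.

Lemma offdiagB_lt0 {k j v} : k != j -> incident k v -> incident j v ->
  v \notin bif_nodes G -> offdiagB len nu k j < 0.
Proof.
move=> ne_kj kv jv nbv; rewrite /offdiagB; case: pickP => [w|/(_ v)]; last first.
  by rewrite kv jv nbv.
(* The node [w] returned by [pick] need not be [v]; being shared by two distinct edges suffices for
   [nu] to be positive there. *)
case/and3P=> kw jw _; rewrite oppr_lt0 !(mulr_gt0, invr_gt0, addr_gt0) ?ltr0n //.
exact/nu_gt0/notin_end_nodes/(degree_gt1 ne_kj).
Qed.

Lemma offdiagB_le0 k j : k != j -> offdiagB len nu k j <= 0.
Proof.
move=> ne_kj; case: (pickP (fun v =>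
  [&& incident k v, incident j v & v \notin bif_nodes G])) => [v|none].
  by case/and3P=> kv jv nbv; apply/ltW/(offdiagB_lt0 ne_kj kv jv).
by rewrite /offdiagB; case: pickP => // v; rewrite none.
Qed.

Lemma Adiff_offdiag_le0 (i j : 'I_(ne G + nbif G)) :
  i != j -> Adiff len nu i j <= 0.
Proof.
rewrite /Adiff; case: (split_ordP i) => i' ->;
  case: (split_ordP j) => j' -> ne_ij.
- rewrite eq_lshift in ne_ij.
  by rewrite block_mxEul mxE (negPf ne_ij) offdiagB_le0.
- by rewrite block_mxEur blockC_le0.
- by rewrite block_mxEdl mxE blockC_le0.
- rewrite eq_rshift in ne_ij.
  by rewrite block_mxEdr mxE (negPf ne_ij).
Qed.

(** The diagonal of [B] balances the rest of the row, [C] included, so only the Dirichlet flux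
    survives. *)
Lemma Adiff_rowsum_edge k : \sum_j Adiff len nu (lshift _ k) j =
  if inflow k \in source_nodes G then nu_at nu k (inflow k) * (2 / len k) else 0.
Proof.
rewrite big_split_ord /=.
under eq_bigr do rewrite block_mxEul.
under [in X in _ + X]eq_bigr do rewrite block_mxEur.
rewrite (bigD1 k) //= [blockB _ _ k k]mxE eqxx.
rewrite (eq_bigr (offdiagB len nu k)) => [|j ne_jk]; last first.
  by rewrite mxE eq_sym (negPf ne_jk).
by rewrite -opprD -addrA addrC addNKr.
Qed.

Lemma Adiff_rowsum_bif j : \sum_i Adiff len nu (rshift _ j) i = 0.
Proof.
rewrite big_split_ord /=.
under eq_bigr do rewrite block_mxEdl mxE.
under [in X in _ + X]eq_bigr do rewrite block_mxEdr mxE.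
by rewrite -big_mkcond (big_pred1 j) ?subrr // => i; rewrite eq_sym.
Qed.

(** The edge [k] itself leaves [inflow k], which is therefore not an end node. *)
Lemma inflow_flux_gt0 k : 0 < nu_at nu k (inflow k) * (2 / len k).
Proof.
rewrite !(mulr_gt0, invr_gt0) ?ltr0n //.
apply: nu_gt0; first exact: incident_inflow.
by rewrite !inE negb_and negbK; apply/orP; right; apply/existsP; exists k.
Qed.

Lemma Adiff_rowsum_ge0 i : 0 <= \sum_j Adiff len nu i j.
Proof.
case: (split_ordP i) => k ->; last by rewrite Adiff_rowsum_bif.
by rewrite Adiff_rowsum_edge; case: ifP => // _; apply/ltW/inflow_flux_gt0.
Qed.

Section ClosedSet.
Variable S : {set 'I_(ne G + nbif G)}.
Hypothesis S_closed : forall i j,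
  i \in S -> i != j -> Adiff len nu i j != 0 -> j \in S.

Lemma closed_bif j k :
  rshift _ j \in S -> incident k (bif_node j) -> lshift _ k \in S.
Proof.
move=> jS kj; apply: S_closed jS _ _; first by rewrite eq_rlshift.
by rewrite block_mxEdl mxE lt_eqF ?blockC_lt0.
Qed.

(** Two edges meeting at a bifurcation node are coupled in two steps, through the unknown of that
    node and the blocks [C] and [C^T]; at any other node they are coupled directly by [B]. *)
Lemma closed_edge k k' v : lshift _ k \in S -> incident k v -> incident k' v ->
  lshift _ k' \in S.
Proof.
move=> kS kv k'v; have [/bif_nodeP[j jv]|nbv] := boolP (v \in bif_nodes G).
  apply: (@closed_bif j); last by rewrite jv.
  apply: S_closed kS _ _; first by rewrite eq_lrshift.
  by rewrite block_mxEur lt_eqF ?blockC_lt0 ?jv.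
have [<- //|ne_kk'] := eqVneq k k'.
apply: S_closed kS _ _; first by rewrite eq_lshift.
by rewrite block_mxEul mxE (negPf ne_kk') lt_eqF ?(offdiagB_lt0 ne_kk' kv k'v).
Qed.

Lemma closed_connected k :
  connected_digraph G -> S != set0 -> lshift _ k \in S.
Proof.
move=> Gconn /set0Pn[i iS].
(* [P] is the property carried along a path of nodes: an edge joining [v] to [x] lies in [S] by
   [P v], and [closed_edge] then brings in all edges at [x]. *)
pose P v := forall k', incident k' v -> lshift (nbif G) k' \in S.
have [v Pv] : exists v, P v.
  case: (split_ordP i) iS => [k0|j] -> iS.
    exists (inflow k0) => k'; apply: closed_edge iS _; exact: incident_inflow.
  by exists (bif_node j) => k'; apply: closed_bif.
suff Pconn w : connect (@adjacent G) v w -> P w.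
  exact: (Pconn _ (Gconn v (inflow k)) k (incident_inflow _ k)).
case/connectP => p; elim: p v Pv => [|x p IHp] v Pv /=; first by move=> _ ->.
case/andP=> /existsP[k' /and3P[k'v k'x _]] xp.
by apply: IHp xp => k''; apply: closed_edge (Pv _ k'v) k'x.
Qed.

End ClosedSet.

Lemma Adiff_chained : connected_digraph G -> (0 < #|source_nodes G|)%N ->
  forall S : {set 'I_(ne G + nbif G)}, S != set0 ->
  (forall i j, i \in S -> i != j -> Adiff len nu i j != 0 -> j \in S) ->
  exists2 i, i \in S & 0 < \sum_j Adiff len nu i j.
Proof.
move=> Gconn /card_gt0P[s s_src] S S0 S_closed.
(* The edge leaving a Dirichlet node lies in every nonempty closed set and has positive row sum. *)
have [k ks] := source_inflow s_src; exists (lshift _ k).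
  exact: closed_connected.
by rewrite Adiff_rowsum_edge ks s_src -ks inflow_flux_gt0.
Qed.

End DiffusionMatrix.

Theorem theorem3 (R : realFieldType) (G : digraph)
    (len : 'I_(ne G) -> R) (nu : 'I_(ne G) -> R -> R)
    (Gsimple : simple_digraph G)
    (Gconn : connected_digraph G)
    (Ginternal : forall v : node G, v \in internal_nodes G ->
       has_incoming v && has_outgoing v)
    (Gsource : (0 < #|source_nodes G|)%N)
    (len_gt0 : forall k, 0 < len k)
    (nu_ge0 : forall k t, 0 <= t <= 1 -> 0 <= nu k t)
    (nu_gt0 : forall (k : 'I_(ne G)) (v : node G),
       incident k v -> v \notin end_nodes G -> 0 < nu_at nu k v) :
  Adiff len nu \in unitmx /\
  forall g u : 'cV[R]_(ne G + nbif G),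
    (forall i, 0 <= g i 0) -> Adiff len nu *m u = g ->
    forall i, 0 <= u i 0.
Proof.
have offdiag := @Adiff_offdiag_le0 _ _ _ _ len_gt0 nu_gt0.
have rowsum := @Adiff_rowsum_ge0 _ _ _ _ len_gt0 nu_gt0.
have chained := @Adiff_chained _ _ _ _ len_gt0 nu_gt0 Gconn Gsource.
split; first exact: weakly_chained_unitmx.
by move=> g u g_ge0 Au; apply: (weakly_chained_monotone _ _ _ offdiag) => //; rewrite Au.
Qed.
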